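(* Let $\mathbb K$ be an algebraically closed field of characteristic zero, let $d\ge0$ be an even integer and let $V$ be an irreducible $\mathfrak{sl}_2(\mathbb K)$-module of dimension $d+1$. Then each of the two $\mathcal A$-module structures on $V$ given in the context (with $x,y,z$ acting as $X,sY,-\mathbf isZ$, respectively as $X,-sY,\mathbf isZ$) is irreducible and of type $B(d)$.
   Context: Let $\mathbf i\in\mathbb K$ with $\mathbf i^2=-1$. $\mathfrak{sl}_2(\mathbb K)$ is the Lie algebra with basis $X,Y,Z$ and bracket $[X,Y]=2\mathbf iZ$, $[Y,Z]=2\mathbf iX$, $[Z,X]=2\mathbf iY$. On every finite-dimensional module, $N_\pm=\tfrac12(\mathbf iY\pm X)$ act nilpotently; $h=\exp(N_-)\exp(N_+)\exp(N_-)$; $k$ acts as $1$ on each odd-dimensional and as $-\mathbf i$ on each even-dimensional irreducible submodule; $s=hk$. $\mathcal A$ is the unital associative $\mathbb K$-algebra with generators $x,y,z$ and relations $xy+yx=2z$, $yz+zy=2x$, $zx+xz=2y$; on every finite-dimensional $\mathfrak{sl}_2(\mathbb K)$-module, the assignments $x,y,z\mapsto X,sY,-\mathbf isZ$ (first structure) and $x,y,z\mapsto X,-sY,\mathbf isZ$ (second structure) define $\mathcal A$-module structures. For even $d\ge0$, an $\mathcal A$-module has type $B(d)$ if it is isomorphic to the $\mathcal A$-module with basis $v_0,\dots,v_d$ on which $y.v_i=(d-i+1)v_{i-1}+(i+1)v_{i+1}$, $x.v_i=(-1)^i(d-2i)v_i$, $z.v_i=(-1)^{i-1}(d-i+1)v_{i-1}+(-1)^i(i+1)v_{i+1}$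 for $0\le i\le d$, where $v_{-1}=v_{d+1}=0$. *)

(* Defs.v *)
From mathcomp Require Import all_boot all_order all_algebra.

Set Implicit Arguments.
Unset Strict Implicit.
Unset Printing Implicit Defensive.

Import GRing.Theory.
Local Open Scope ring_scope.

(* Throughout, [ii : K] is the chosen square root of -1, written "i" in the
   comments. Products of endomorphisms are written \o: as in the usual
   convention for left modules, (f \o g)%VF v = f (g v). *)

(** * The Lie algebra sl_2 *)

(* The underlying space is K^3, the standard basis being X, Y, Z. *)
Definition sl2 (K : fieldType) : lmodType K := 'rV[K]_3.

Definition sl2X (K : fieldType) : sl2 K := 'e_0.
Definition sl2Y (K : fieldType) : sl2 K := 'e_1.
Definition sl2Z (K : fieldType) : sl2 K := 'e_2.

Section Sl2.
Variables (K : fieldType) (ii : K).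

(* 2i times the cross product; the indices k + 1 and k + 2 are in Z/3. See
   sl2_bracketXY, sl2_bracketYZ, sl2_bracketZX for the brackets of the basis. *)
Definition sl2_bracket (u v : sl2 K) : sl2 K :=
  \row_(k < 3) (2 * ii * (u 0 (k + 1) * v 0 (k + 2)
                          - u 0 (k + 2) * v 0 (k + 1))).

Lemma sl2_bracketXY : sl2_bracket (sl2X K) (sl2Y K) = (2 * ii) *: sl2Z K.
Proof.
apply/rowP => k; rewrite !mxE /=.
by case: k => -[|[|[|//]]] Hk; rewrite -!val_eqE /=
  ?(mulr0, mul0r, mulr1, subr0, subrr).
Qed.

Lemma sl2_bracketYZ : sl2_bracket (sl2Y K) (sl2Z K) = (2 * ii) *: sl2X K.
Proof.
apply/rowP => k; rewrite !mxE /=.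
by case: k => -[|[|[|//]]] Hk; rewrite -!val_eqE /=
  ?(mulr0, mul0r, mulr1, subr0, subrr).
Qed.

Lemma sl2_bracketZX : sl2_bracket (sl2Z K) (sl2X K) = (2 * ii) *: sl2Y K.
Proof.
apply/rowP => k; rewrite !mxE /=.
by case: k => -[|[|[|//]]] Hk; rewrite -!val_eqE /=
  ?(mulr0, mul0r, mulr1, subr0, subrr).
Qed.

Lemma sl2_bracketvv u : sl2_bracket u u = 0.
Proof. by apply/rowP => k; rewrite !mxE [X in _ - X]mulrC subrr mulr0. Qed.

End Sl2.

Section Sl2Modules.
Variables (K : fieldType) (ii : K) (V : vectType K).

Definition sl2_module (rho : {linear sl2 K -> 'End(V)}) : Prop :=
  forall u v : sl2 K,
    rho (sl2_bracket ii u v) = (rho u \o rho v)%VF - (rho v \o rho u)%VF.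

Variable rho : {linear sl2 K -> 'End(V)}.

Definition sl2_submodule (U : {vspace V}) : Prop :=
  forall u : sl2 K, (rho u @: U <= U)%VS.

Definition sl2_irreducible (U : {vspace V}) : Prop :=
  [/\ sl2_submodule U, U != 0%VS
    & forall W : {vspace V}, sl2_submodule W -> (W <= U)%VS ->
        W = 0%VS \/ W = U].

(** * The operators h, k and s *)

Definition lfun_iter (f : 'End(V)) (n : nat) : 'End(V) :=
  iter n (comp_lfun f) \1%VF.

(* This is the exponential of f when f is nilpotent, since then the powers
   f^n with n >= dim V vanish; it is only used for the nilpotent N+ and N-. *)
Definition exp_nilpotent (f : 'End(V)) : 'End(V) :=
  \sum_(n < \dim {:V}) (n`!%:R)^-1 *: lfun_iter f n.

Definition Nplus : 'End(V) :=
  2^-1 *: (ii *: rho (sl2Y K) + rho (sl2X K)).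
Definition Nminus : 'End(V) :=
  2^-1 *: (ii *: rho (sl2Y K) - rho (sl2X K)).

Definition h_op : 'End(V) :=
  (exp_nilpotent Nminus \o exp_nilpotent Nplus \o exp_nilpotent Nminus)%VF.

(* Modules being completely reducible in characteristic 0, this determines the
   operator k; see is_k_op_irreducible for the case of irreducible modules. *)
Definition is_k_op (k : 'End(V)) : Prop :=
  forall U : {vspace V}, sl2_irreducible U ->
  forall v, v \in U -> k v = (if odd (\dim U) then v else - ii *: v).

Definition s_op (k : 'End(V)) : 'End(V) := (h_op \o k)%VF.

Lemma is_k_op_irreducible (k : 'End(V)) : sl2_irreducible fullv ->
  is_k_op k <-> k = (if odd (\dim {:V}) then \1%VF else - ii *: \1%VF).
Proof.
move=> irrV; have [_ _ simpleV] := irrV; split=> [kP|->].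
  apply/lfunP => v; rewrite (kP _ irrV v (memvf v)).
  by case: ifP; rewrite ?scale_lfunE id_lfunE.
move=> U [subU U0 _] v _; have [UV|->] := simpleV U subU (subvf U).
  by rewrite UV eqxx in U0.
by case: ifP; rewrite ?scale_lfunE id_lfunE.
Qed.

End Sl2Modules.

(** * The algebra A *)

(* A being given by generators and relations, an A-module structure on V is
   the same as three endomorphisms x, y, z of V satisfying the relations, and
   a submodule is a subspace stable under the three of them. *)
Section AModules.
Variables (K : fieldType).

Definition A_module (V : vectType K) (x y z : 'End(V)) : Prop :=
  [/\ (x \o y)%VF + (y \o x)%VF = 2 *: z,
      (y \o z)%VF + (z \o y)%VF = 2 *: x
    & (z \o x)%VF + (x \o z)%VF = 2 *: y].

Definition A_submodule (V : vectType K) (x y z : 'End(V))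
    (W : {vspace V}) : Prop :=
  [/\ (x @: W <= W)%VS, (y @: W <= W)%VS & (z @: W <= W)%VS].

Definition A_irreducible (V : vectType K) (x y z : 'End(V)) : Prop :=
  {:V}%VS != 0%VS /\
  forall W : {vspace V}, A_submodule x y z W -> W = 0%VS \/ W = fullv.

Definition A_isomorphic (V : vectType K) (x y z : 'End(V))
    (V' : vectType K) (x' y' z' : 'End(V')) : Prop :=
  exists f : 'Hom(V, V'),
    [/\ bijective f, forall v, f (x v) = x' (f v),
        forall v, f (y v) = y' (f v) & forall v, f (z v) = z' (f v)].

Variable d : nat.

(* The basis vector v_j of K^(d+1) when 0 <= j <= d, and 0 for all other
   integers j, in particular for j = -1 and j = d + 1. *)
Definition Bvec (j : int) : 'rV[K]_d.+1 := \row_(k < d.+1) (j == k%:Z)%:R.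

(* The endomorphism of K^(d+1) mapping v_i to F i, for 0 <= i <= d. *)
Definition Bend (F : nat -> 'rV[K]_d.+1) : 'End('rV[K]_d.+1) :=
  linfun (mulmxr (\matrix_(i < d.+1) F i)).

Lemma BendE F (i : nat) : (i <= d)%N -> Bend F (Bvec i%:Z) = F i.
Proof.
move=> le_id; rewrite lfunE /=.
have -> : Bvec i%:Z = 'e_(inord i : 'I_d.+1).
  apply/rowP => k; rewrite !mxE eqxx /= eqz_nat -val_eqE /= inordK //.
  by rewrite eq_sym.
by rewrite -rowE rowK inordK.
Qed.

(* The sign (-1)^(i-1) is written (-1)^(i+1) to avoid a negative exponent. *)
Definition Bx : 'End('rV[K]_d.+1) :=
  Bend (fun i => ((-1) ^+ i * (d%:R - 2 * i%:R)) *: Bvec i%:Z).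
Definition By : 'End('rV[K]_d.+1) :=
  Bend (fun i => (d%:R - i%:R + 1) *: Bvec (i%:Z - 1)
                 + (i%:R + 1) *: Bvec (i%:Z + 1)).
Definition Bz : 'End('rV[K]_d.+1) :=
  Bend (fun i => ((-1) ^+ i.+1 * (d%:R - i%:R + 1)) *: Bvec (i%:Z - 1)
                 + ((-1) ^+ i * (i%:R + 1)) *: Bvec (i%:Z + 1)).

Definition A_type_B (V : vectType K) (x y z : 'End(V)) : Prop :=
  A_isomorphic x y z Bx By Bz.

End AModules.

(* Main.v *)
(* On V the operator k is the identity, so s = h. For an sl_2-triple E, H, F
   acting irreducibly on a space of dimension d + 1, a highest weight vector
   yields a basis w_0, ..., w_d on which the triple acts by the usual formulas.
   For the triple N+, Z, -N-, conjugating by exponentials shows that h exchanges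
   N+ and N- and anticommutes with Z, that is, h commutes with Y and anticommutes
   with X and Z; on the weight basis h (w_(d-i)) = (-1)^i w_i, so h^2 = 1 as d is
   even. Both structures are thus twists of V by an involution s (namely h or -h)
   commuting with Y and anticommuting with X and Z.
   If W is an A-submodule, then the intersection and the sum of W and s W are
   stable under sl_2, hence 0 or V; as dim V is odd, V is not the direct sum of W
   and s W, so W = 0 or W = V.
   If now w_0, ..., w_d is the weight basis for a triple with H = X, then
   v_i = s^i w_i is a basis as in the definition of type B(d). *)
From HB Require Import structures.
Require Import Defs.
From mathcomp Require Import all_boot all_order all_algebra ring.

Set Implicit Arguments.
Unset Strict Implicit.
Unset Printing Implicit Defensive.

Import GRing.Theory passmx.
Local Open Scope ring_scope.

(** * Linear algebra: linear forms, eigenvectors and free families *)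

Lemma eq_scalar (K : fieldType) (V : vectType K) (u v : V) :
  (forall phi : {scalar V}, phi u = phi v) -> u = v.
Proof.
move=> eq_phi; rewrite (coord_vbasis (memvf u)) (coord_vbasis (memvf v)).
by apply: eq_bigr => i _; rewrite (eq_phi (coord (vbasis fullv) i)).
Qed.

(** [ring] and [field] act on scalars only, so an identity of vectors is first evaluated at an
    arbitrary linear form [phi]. *)
Ltac module_expand phi :=
  rewrite !(linearD phi, linearN phi, linear0 phi, scalarZ phi) /=.
Ltac module_ring :=
  let phi := fresh in apply: eq_scalar; intro phi; module_expand phi; ring.

Lemma eigenvectors_free (K : fieldType) (V : vectType K) (T : eqType)
  (f : 'End(V)) (w : T -> V) (mu : T -> K) (s : seq T) :
  uniq s -> {in s &, injective mu} -> {in s, forall t, w t != 0} ->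
  {in s, forall t, f (w t) = mu t *: w t} -> free (map w s).
Proof.
elim: s => [|a s IHs] /=; first by rewrite nil_free.
case/andP=> aNs uniq_s inj_mu nz_w fw.
have subs t : t \in s -> t \in a :: s by rewrite inE orbC => ->.
have free_s : free (map w s).
  apply: IHs => // [t u ts us|t ts|t ts]; last 2 first.
  - exact: nz_w (subs t ts).
  - exact: fw (subs t ts).
  exact: inj_mu (subs t ts) (subs u us).
rewrite free_cons free_s andbT; apply/negP => wa_s.
have /eqP[] := nz_w a (mem_head a s).
have szw : size (map w s) == size s by rewrite size_map.
pose X := Tuple szw; pose c i := coord X i (w a).
have wE (i : 'I_(size s)) : X`_i = w (nth a s i) by rewrite (nth_map a).
have Dwa : w a = \sum_i c i *: X`_i by apply: coord_span.
have c0 i : c i = 0.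
  (* Applying [mu a - f] to the expansion of [w a] kills the left side and multiplies the i-th
     coefficient by [mu a - mu (nth a s i)]. *)
  have := freeP (X := X) free_s (fun i => c i * (mu a - mu (nth a s i))).
  have -> : \sum_i (c i * (mu a - mu (nth a s i))) *: X`_i
            = mu a *: w a - f (w a).
    rewrite {2}Dwa {1}Dwa scaler_sumr linear_sum -sumrB /=.
    apply: eq_bigr => j _.
    rewrite [f _]linearZZ wE /= fw; last by rewrite subs ?mem_nth.
    by rewrite !scalerA -scalerBl; congr (_ *: _); ring.
  rewrite fw ?mem_head // subrr => /(_ erefl i) /eqP.
  rewrite mulf_eq0 subr_eq0 => /orP[/eqP //|/eqP /inj_mu Ea].
  by move: aNs; rewrite Ea ?mem_head ?mem_nth // subs ?mem_nth.
by rewrite Dwa big1 // => i _; rewrite c0 scale0r.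
Qed.

Lemma free_size_le_dim (K : fieldType) (V : vectType K) (s : seq V) :
  free s -> (size s <= \dim {:V})%N.
Proof. by rewrite /free => /eqP <-; apply/dimvS/subvf. Qed.

Lemma eigenvector_exists (K : closedFieldType) (V : vectType K) (f : 'End(V)) :
  {:V}%VS != 0%VS -> exists mu, exists2 u : V, u != 0 & f u = mu *: u.
Proof.
move=> nzV; pose e := vbasis {:V}.
have e_basis : basis_of {:V} e by apply: vbasisP.
have [mu] : exists mu, root (char_poly (mxof e e f)) mu.
  by apply/closed_rootP; rewrite size_char_poly eqSS dimv_eq0.
rewrite -eigenvalue_root_char => /eigenvalueP[u uf nzu].
exists mu, (vecof e u); first by rewrite (vecof_eq0 e_basis).
by rewrite (hom_vecof e e_basis) uf linearZ.
Qed.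

(** * Chains of eigenvectors in characteristic zero *)

Section CharacteristicZero.
Variables (K : fieldType) (charK0 : [pchar K] =i pred0).

Lemma natr_eq0_pchar0 n : (n%:R == 0 :> K) = (n == 0)%N.
Proof. exact: (iffLR (pcharf0P K) charK0). Qed.

Lemma natr_inj_pchar0 : injective (fun n => n%:R : K).
Proof.
move=> m n /= /eqP Emn; apply/eqP; rewrite eqn_leq -!subn_eq0.
wlog le_mn : m n Emn / (m <= n)%N.
  by move=> IH; case/orP: (leq_total m n) => [/IH|/IH]; rewrite 1?andbC; apply;
     rewrite // eq_sym.
by rewrite [(m - n == 0)%N]le_mn /= -natr_eq0_pchar0 natrB // subr_eq0 eq_sym.
Qed.

(** Each application of [g] shifts the eigenvalue by [c]. If the first [\dim {:V} + 1] iterates were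
    all nonzero, they would be eigenvectors for distinct values [mu + n c], hence too many
    independent vectors. *)
Lemma eigenvector_chain_vanishes (V : vectType K) (f g : 'End(V)) (c mu : K)
  (u : V) : c != 0 -> (forall v, f (g v) = g (f v) + c *: g v) ->
  f u = mu *: u -> exists n, iter n g u = 0.
Proof.
move=> nzc fg fu.
have fgn n : f (iter n g u) = (mu + n%:R * c) *: iter n g u.
  elim: n => [|n IHn]; first by rewrite mul0r addr0.
  by rewrite iterS fg IHn linearZ /= -scalerDl -natr1; congr (_ *: _); ring.
have [/existsP[n /eqP gn0]|] :=
  boolP [exists n : 'I_(\dim {:V}).+1, iter n g u == 0]; first by exists n.
rewrite negb_exists => /forallP nz_g.
suff /free_size_le_dim : free [seq iter n g u | n <- iota 0 (\dim {:V}).+1].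
  by rewrite size_map size_iota ltnn.
apply: (@eigenvectors_free _ _ _ f _ (fun n => mu + n%:R * c)).
- exact: iota_uniq.
- by move=> m n _ _ /addrI /(mulIf nzc) /natr_inj_pchar0.
- by move=> n; rewrite mem_iota => lt_n; apply: nz_g (Ordinal lt_n).
- by move=> n _; apply: fgn.
Qed.

End CharacteristicZero.

(** * Rewriting rules for linear maps *)

Section LinearMaps.
Variables (K : fieldType) (U V : vectType K) (f : 'Hom(U, V)).

Lemma homD u v : f (u + v) = f u + f v. Proof. exact: linearD. Qed.
Lemma homN u : f (- u) = - f u. Proof. exact: linearN. Qed.
Lemma homZ a u : f (a *: u) = a *: f u. Proof. exact: linearZ. Qed.
Lemma hom0 : f 0 = 0. Proof. exact: linear0. Qed.

Lemma homB u v : f (u - v) = f u - f v. Proof. exact: linearB. Qed.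

Lemma hom_sum I (r : seq I) (P : pred I) (F : I -> U) :
  f (\sum_(i <- r | P i) F i) = \sum_(i <- r | P i) f (F i).
Proof. exact: linear_sum. Qed.

End LinearMaps.

Definition homE := (homD, homN, homZ, hom0).

Lemma lfun_imgP (K : fieldType) (V : vectType K) (f : 'End(V))
  (W W' : {vspace V}) :
  reflect (forall v, v \in W -> f v \in W') (f @: W <= W')%VS.
Proof.
apply: (iffP subvP) => [fW v vW|fW _ /memv_imgP[v vW ->]]; last exact: fW.
exact/fW/memv_img.
Qed.

(** * Triples, divided powers and weight bases *)

Section Triples.
Variables (K : fieldType) (V : vectType K) (E H F : 'End(V)).

Record sl2_triple : Prop := Sl2Triple {
  tripleHE : forall v, H (E v) = E (H v) + 2 *: E v;
  tripleHF : forall v, H (F v) = F (H v) - 2 *: F v;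
  tripleEF : forall v, E (F v) = F (E v) + H v
}.

Definition triple_irreducible : Prop :=
  forall W : {vspace V}, (E @: W <= W)%VS -> (H @: W <= W)%VS ->
    (F @: W <= W)%VS -> W = 0%VS \/ W = fullv.

(** The sequence runs over all naturals and vanishes past [d], so the formulas for [E] and [F] need
    no upper bound on [i]. The normalisation is [w i = F^i (w 0) / i!]. *)
Record weight_basis (d : nat) (w : nat -> V) : Prop := WeightBasis {
  weightH : forall i, H (w i) = (d%:R - 2 * i%:R) *: w i;
  weightF : forall i, F (w i) = i.+1%:R *: w i.+1;
  weightE0 : E (w 0%N) = 0;
  weightE : forall i, E (w i.+1) = (d%:R - i%:R) *: w i;
  weight_gt : forall i, (d < i)%N -> w i = 0;
  weight_span : basis_of fullv (mkseq w d.+1)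
}.

End Triples.

(* Locked: otherwise conversion starts computing factorials. *)
HB.lock Definition divpow (K : fieldType) (V : vectType K) (f : 'End(V))
  (n : nat) (v : V) : V := (n`!%:R)^-1 *: iter n f v.

Lemma divpowE (K : fieldType) (V : vectType K) (f : 'End(V)) n v :
  divpow f n v = (n`!%:R)^-1 *: iter n f v.
Proof. by rewrite divpow.unlock. Qed.

Section DividedPowers.
Variables (K : fieldType) (V : vectType K) (f : 'End(V)).

Lemma divpow0 v : divpow f 0 v = v.
Proof. by rewrite !divpowE invr1 scale1r. Qed.

Lemma divpowS (charK0 : [pchar K] =i pred0) n v :
  f (divpow f n v) = n.+1%:R *: divpow f n.+1 v.
Proof.
rewrite !divpowE homZ scalerA factS natrM invfM mulrA mulfV ?mul1r //.
by rewrite natr_eq0_pchar0.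
Qed.

End DividedPowers.

(** [E] raises an eigenvector of [H] up to a vector [w0] that it kills. The divided powers of [F] on
    [w0] span a stable subspace, which irreducibility makes all of [V]. *)
Lemma weight_basis_exists (K : closedFieldType) (charK0 : [pchar K] =i pred0)
  (V : vectType K) (d : nat) (E H F : 'End(V)) :
  \dim {:V} = d.+1 -> sl2_triple E H F -> triple_irreducible E H F ->
  exists w, weight_basis E H F d w.
Proof.
move=> dimV [HE HF EF] irr.
have nz2 : 2 != 0 :> K by rewrite natr_eq0_pchar0.
have nzS n : n.+1%:R != 0 :> K by rewrite natr_eq0_pchar0.
have [mu [u nzu Hu]] : exists mu, exists2 u : V, u != 0 & H u = mu *: u.
  by apply: eigenvector_exists; rewrite -dimv_eq0 dimV.
have [w0 [lam [nzw0 Ew0 Hw0]]] :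
    exists w0, exists lam, [/\ w0 != 0, E w0 = 0 & H w0 = lam *: w0].
  have exE : exists n, iter n E u == 0.
    by have [n /eqP] := eigenvector_chain_vanishes charK0 nz2 HE Hu; exists n.
  case: (ex_minnP exE) => -[|n] /eqP En0 min_n; first by case/eqP: nzu.
  have HEn m : H (iter m E u) = (mu + m%:R * 2) *: iter m E u.
    elim: m => [|m IHm]; first by rewrite mul0r addr0.
    by rewrite iterS HE IHm homZ -scalerDl -natr1; congr (_ *: _); ring.
  exists (iter n E u), (mu + n%:R * 2); split=> //.
  by apply/negP => /min_n; rewrite ltnn.
pose w n := divpow F n w0.
have Fw i : F (w i) = i.+1%:R *: w i.+1 by apply: divpowS.
have Hw i : H (w i) = (lam - 2 * i%:R) *: w i.
  elim: i => [|i IHi]; first by rewrite /w divpow0 mulr0 subr0.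
  apply: (scalerI (nzS i)); rewrite -homZ -Fw HF IHi homZ -scalerBl Fw.
  by rewrite !scalerA -natr1; congr (_ *: _); ring.
have Ew i : E (w i.+1) = (lam - i%:R) *: w i.
  elim: i => [|i IHi].
    have := EF (w 0%N); rewrite Fw scale1r Hw {1 2}/w divpow0 Ew0 hom0 add0r.
    by rewrite mulr0.
  apply: (scalerI (nzS i.+1)); rewrite -homZ -Fw EF IHi homZ Fw Hw !scalerA.
  by rewrite -scalerDl -!natr1; congr (_ *: _); ring.
have exF : exists n, w n == 0.
  have nzN2 : - 2 != 0 :> K by rewrite oppr_eq0.
  have HF' v : H (F v) = F (H v) + (- 2) *: F v by rewrite HF scaleNr.
  have [n Fn0] := eigenvector_chain_vanishes charK0 nzN2 HF' Hw0.
  by exists n; rewrite /w divpowE Fn0 scaler0.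
case: (ex_minnP exF) => -[|n] /eqP wn0 min_n.
  by move: nzw0; rewrite -[w0](divpow0 F) -/(w 0%N) wn0 eqxx.
have wgt i : (n < i)%N -> w i = 0.
  elim: i => // i IHi; rewrite ltnS leq_eqVlt => /orP[/eqP <- //|/IHi wi0].
  by apply: (scalerI (nzS i)); rewrite -Fw wi0 hom0 scaler0.
(* [w n] is the last nonzero vector of the chain, so [0 = E (w n.+1) = (lam - n) w n] determines the
   highest weight. *)
have lamE : lam = n%:R.
  have /eqP := Ew n; rewrite wn0 hom0 eq_sym scaler_eq0 subr_eq0.
  by case/orP=> [/eqP //|/min_n]; rewrite ltnn.
have w_free : free (mkseq w n.+1).
  apply: (@eigenvectors_free _ _ _ H _ (fun i => lam - 2 * i%:R)).
  - exact: iota_uniq.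
  - by move=> i j _ _ /addrI /oppr_inj /(mulfI nz2) /natr_inj_pchar0; apply.
  - move=> i; rewrite mem_iota ltnS /= => le_in; apply/negP => /min_n.
    by rewrite ltnNge le_in.
  - by move=> i _; apply: Hw.
have wS i : w i \in <<mkseq w n.+1>>%VS.
  have [le_in|/wgt ->] := leqP i n; last exact: mem0v.
  by apply/memv_span/map_f; rewrite mem_iota.
have stable (f : 'End(V)) : (forall i, f (w i) \in <<mkseq w n.+1>>%VS) ->
    (f @: <<mkseq w n.+1>> <= <<mkseq w n.+1>>)%VS.
  move=> fw; rewrite limg_span; apply/span_subvP => v.
  by case/mapP=> _ /mapP[i _ ->] ->.
have w_span : <<mkseq w n.+1>>%VS = fullv.
  have [] // := irr <<mkseq w n.+1>>%VS.
  - apply: stable => -[|i]; last by rewrite Ew memvZ.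
    by rewrite /w divpow0 Ew0 mem0v.
  - by apply: stable => i; rewrite Hw memvZ.
  - by apply: stable => i; rewrite Fw memvZ.
  - move=> w0_; move: (wS 0%N); rewrite w0_ memv0 /w divpow0.
    by rewrite (negPf nzw0).
have w_basis : basis_of fullv (mkseq w n.+1).
  by rewrite basisEfree w_free w_span subvf -w_span (eqP w_free) /=.
have nd : n = d.
  by apply: succn_inj; rewrite -dimV -w_span (eqP w_free) size_mkseq.
rewrite nd in wgt lamE w_basis.
by exists w; split=> //; [move=> i|rewrite /w divpow0|move=> i]; rewrite -?lamE.
Qed.

Lemma weight_basis_ext (K : fieldType) (V U : vectType K) (E H F : 'End(V))
  (d : nat) (w : nat -> V) (f g : 'Hom(V, U)) :
  weight_basis E H F d w ->
  (forall i, (i <= d)%N -> f (w i) = g (w i)) -> f = g.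
Proof.
move=> wb fg; apply/lfunP => v.
have /span_basis w_span := weight_span wb.
suff /subvP/(_ v (memvf v)) : (fullv <= lker (f - g))%VS.
  by rewrite memv_ker add_lfunE opp_lfunE subr_eq0 => /eqP.
rewrite -w_span; apply/span_subvP => _ /mapP[i lt_i ->].
rewrite memv_ker add_lfunE opp_lfunE fg ?subrr // -ltnS.
by rewrite mem_iota in lt_i.
Qed.

(** * Exponentials of nilpotent endomorphisms *)

Lemma lfun_iterE (K : fieldType) (V : vectType K) (f : 'End(V)) n v :
  lfun_iter f n v = iter n f v.
Proof.
by elim: n => [|n IHn]; rewrite /lfun_iter /= lfunE //= -/(lfun_iter f n) IHn.
Qed.

Lemma iter_hom0 (K : fieldType) (V : vectType K) (f : 'End(V)) n :
  iter n f 0 = 0.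
Proof. by elim: n => //= n ->; rewrite hom0. Qed.

Lemma divpow_comm (K : fieldType) (V W : vectType K) (f : 'End(V)) (g : 'End(W))
  (h : 'Hom(V, W)) n v :
  (forall u, h (f u) = g (h u)) -> h (divpow f n v) = divpow g n (h v).
Proof.
move=> hf; rewrite !divpowE homZ; congr (_ *: _).
by elim: n => //= n IHn; rewrite hf IHn.
Qed.

Section Exponential.
Variables (K : fieldType) (charK0 : [pchar K] =i pred0) (V : vectType K).
Variable f : 'End(V).
Hypothesis f_nil : forall v, iter (\dim {:V}) f v = 0.

Lemma divpow_nilpotent n v : (\dim {:V} <= n)%N -> divpow f n v = 0.
Proof.
move=> /subnK <-; rewrite divpowE iterD f_nil.
by rewrite iter_hom0 scaler0.
Qed.

(** Terms of degree at least [\dim {:V}] vanish, so the series may be cut at any later point; this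
    allows sums of different lengths to be compared. *)
Lemma exp_nilpotent_sum m v : (\dim {:V} <= m)%N ->
  exp_nilpotent f v = \sum_(n < m) divpow f n v.
Proof.
move=> le_m; rewrite /exp_nilpotent sum_lfunE.
rewrite (big_ord_widen _ (fun n => ((n`!%:R)^-1 *: lfun_iter f n) v) le_m).
rewrite big_mkcond; apply: eq_bigr => n _.
have [_|le_n] := ltnP n (\dim {:V}); last by rewrite divpow_nilpotent.
by rewrite scale_lfunE lfun_iterE divpowE.
Qed.

Lemma exp_nilpotent_fixed v : f v = 0 -> exp_nilpotent f v = v.
Proof.
move=> fv; rewrite (@exp_nilpotent_sum (\dim {:V}).+1) // big_ord_recl.
rewrite divpow0 big1 ?addr0 // => i _.
by rewrite divpowE iterSr fv iter_hom0 scaler0.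
Qed.

(* The three terms of [divpow_conj] and [exp_nilpotent_conj] come from the series
   exp(ad f)(B) = B + [f, B] + [f, [f, B]] / 2 + ..., truncated after degree 2. *)
Lemma divpow_conj (B C D : 'End(V)) :
  (forall v, f (B v) = B (f v) + C v) ->
  (forall v, f (C v) = C (f v) + 2 *: D v) ->
  (forall v, f (D v) = D (f v)) ->
  forall n v, divpow f n.+2 (B v)
    = B (divpow f n.+2 v) + C (divpow f n.+1 v) + D (divpow f n v).
Proof.
move=> fB fC fD n v.
have nzS m : m.+1%:R != 0 :> K by rewrite natr_eq0_pchar0.
have dB1 : divpow f 1 (B v) = B (divpow f 1 v) + C (divpow f 0 v).
  by rewrite !divpowE /= invr1 !scale1r.
elim: n => [|n IHn]; [apply: (scalerI (nzS 1%N))|apply: (scalerI (nzS n.+2))].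
  by rewrite -divpowS // dB1 !homD fB fC !divpowS // !homE; module_ring.
by rewrite -divpowS // IHn !homD fB fC fD !divpowS // !homE; module_ring.
Qed.

Lemma exp_nilpotent_conj (B C D : 'End(V)) :
  (forall v, f (B v) = B (f v) + C v) ->
  (forall v, f (C v) = C (f v) + 2 *: D v) ->
  (forall v, f (D v) = D (f v)) ->
  forall v, exp_nilpotent f (B v) = B (exp_nilpotent f v)
    + C (exp_nilpotent f v) + D (exp_nilpotent f v).
Proof.
move=> fB fC fD v; pose S m u := \sum_(n < m) divpow f n u.
have SS m u : S m.+1 u = S m u + divpow f m u by rewrite /S big_ord_recr.
(* [C] and [D] come with degrees lowered by one and two, whence the lengths [m + 2], [m + 1] and
   [m]; from [m = \dim {:V}] on, all three sums are the exponential. *)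
have SB m : S m.+2 (B v) = B (S m.+2 v) + C (S m.+1 v) + D (S m v).
  elim: m => [|m IHm].
    have S0 u : S 0%N u = 0 by rewrite /S big_ord0.
    rewrite !SS !S0 !add0r hom0 addr0 !divpow0 homD -addrA; congr (_ + _).
    by rewrite !divpowE /= invr1 !scale1r.
  rewrite SS IHm (divpow_conj fB fC fD) (SS m.+2 v) (SS m.+1 v) (SS m v) !homD.
  by rewrite -!/(S _ _); module_ring.
have expS m u : (\dim {:V} <= m)%N -> exp_nilpotent f u = S m u.
  exact: exp_nilpotent_sum.
have leD := leqnn (\dim {:V}).
by rewrite (expS _ (B v) (leqW (leqW leD))) SB -!expS // ?leqW.
Qed.

End Exponential.

(** * The Weyl element and its square *)

Section WeylElement.
Variables (K : fieldType) (charK0 : [pchar K] =i pred0) (V : vectType K).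
Variables (d : nat) (E H G : 'End(V)) (w : nat -> V).
Hypotheses (dimV : \dim {:V} = d.+1) (triple : sl2_triple E H (- G)).
Hypothesis wb : weight_basis E H (- G) d w.

Lemma lowering_weight i : G (w i) = - i.+1%:R *: w i.+1.
Proof.
by rewrite scaleNr -(weightF wb) opp_lfunE opprK.
Qed.

(** Since [E (w (d - n)) = (n + 1) w (d - n - 1)] for [n < d], the basis read from its lowest vector
    consists of divided powers of [E]. *)
Lemma divpow_raising n : (n <= d)%N -> divpow E n (w d) = w (d - n)%N.
Proof.
elim: n => [|n IHn] lt_nd; first by rewrite divpow0 subn0.
have nzn : n.+1%:R != 0 :> K by rewrite natr_eq0_pchar0.
apply: (scalerI nzn); rewrite -divpowS // IHn ?(ltnW lt_nd) //.
rewrite -[in LHS](subnSK lt_nd) (weightE wb) natrB //.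
by congr (_ *: _); ring.
Qed.

Lemma divpow_lowering n : divpow G n (w 0) = (-1) ^+ n *: w n.
Proof.
elim: n => [|n IHn]; first by rewrite divpow0 scale1r.
have nzn : n.+1%:R != 0 :> K by rewrite natr_eq0_pchar0.
apply: (scalerI nzn); rewrite -divpowS // IHn homZ lowering_weight.
by rewrite !scalerA exprS; congr (_ *: _); ring.
Qed.

Lemma raising_nilpotent v : iter (\dim {:V}) E v = 0.
Proof.
suff E0 : lfun_iter E d.+1 = 0 by rewrite dimV -lfun_iterE E0 lfunE.
apply: (weight_basis_ext wb) => i le_id; rewrite lfun_iterE lfunE /=.
suff Ei n : iter n E (w i) = if (n <= i)%N then
    \prod_(j < n) (d%:R - (i - j.+1)%:R) *: w (i - n)%N else 0.
  by rewrite -iterS Ei ltnNge le_id.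
elim: n => [|n IHn]; first by rewrite big_ord0 scale1r subn0.
rewrite iterS IHn; case: (ltngtP n i) => [lt_ni|lt_in|->]; rewrite ?hom0 //.
  by rewrite homZ -(subnSK lt_ni) (weightE wb) scalerA big_ord_recr.
by rewrite homZ subnn (weightE0 wb) scaler0.
Qed.

Lemma lowering_iter n i : iter n G (w i) =
  \prod_(j < n) (- (i + j).+1%:R) *: w (i + n)%N.
Proof.
elim: n => [|n IHn]; first by rewrite big_ord0 scale1r addn0.
by rewrite iterS IHn homZ lowering_weight scalerA big_ord_recr addnS.
Qed.

Lemma lowering_nilpotent v : iter (\dim {:V}) G v = 0.
Proof.
suff G0 : lfun_iter G d.+1 = 0 by rewrite dimV -lfun_iterE G0 lfunE.
apply: (weight_basis_ext wb) => i le_id; rewrite lfun_iterE lfunE /=.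
by rewrite -iterS lowering_iter (weight_gt wb) ?scaler0 ?ltn_addl.
Qed.

(** The lowering operator of the triple is [F = - G], so this is [exp(-F) exp(E) exp(-F)], the usual
    lift of the nontrivial Weyl group element. *)
Let h : 'End(V) := (exp_nilpotent G \o exp_nilpotent E \o exp_nilpotent G)%VF.

Lemma weylE v : h v = exp_nilpotent G (exp_nilpotent E (exp_nilpotent G v)).
Proof. by rewrite /h !comp_lfunE. Qed.

Let EG v : E (G v) = G (E v) - H v.
Proof.
have := tripleEF triple v; rewrite !opp_lfunE homN => /(congr1 -%R).
by rewrite opprK opprD opprK.
Qed.

Let HG v : H (G v) = G (H v) - 2 *: G v.
Proof.
have := tripleHF triple v; rewrite !opp_lfunE homN => /(congr1 -%R).
by rewrite opprK opprD !opprK scalerN.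
Qed.

(** The brackets [[G, E] = H] and [[G, H] = 2 G] end the series at [G]. For [exp_nilpotent E] below,
    [[E, G] = - H] and [[E, - H] = 2 E] play the same part. *)
Let expG_E v : exp_nilpotent G (E v) = E (exp_nilpotent G v)
  + H (exp_nilpotent G v) + G (exp_nilpotent G v).
Proof.
apply: (exp_nilpotent_conj charK0 lowering_nilpotent) => [u|u|//].
  by rewrite EG subrK.
by rewrite HG subrK.
Qed.

Let expG_H v : exp_nilpotent G (H v) = H (exp_nilpotent G v)
  + 2 *: G (exp_nilpotent G v).
Proof.
rewrite (@exp_nilpotent_conj _ charK0 _ _ lowering_nilpotent
  H (2 *: G) 0) => [|u|u|u];
  rewrite ?scale_lfunE ?zero_lfunE ?scaler0 ?addr0 //.
- by rewrite HG subrK.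
- by rewrite homZ.
- by rewrite hom0.
Qed.

Let expG_G v : exp_nilpotent G (G v) = G (exp_nilpotent G v).
Proof.
by rewrite (@exp_nilpotent_conj _ charK0 _ _ lowering_nilpotent
  G 0 0) => [|u|u|u];
  rewrite ?zero_lfunE ?scaler0 ?addr0 ?hom0.
Qed.

Let expE_E v : exp_nilpotent E (E v) = E (exp_nilpotent E v).
Proof.
by rewrite (@exp_nilpotent_conj _ charK0 _ _ raising_nilpotent
  E 0 0) => [|u|u|u];
  rewrite ?zero_lfunE ?scaler0 ?addr0 ?hom0.
Qed.

Let expE_G v : exp_nilpotent E (G v) = G (exp_nilpotent E v)
  - H (exp_nilpotent E v) + E (exp_nilpotent E v).
Proof.
rewrite (@exp_nilpotent_conj _ charK0 _ _ raising_nilpotent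
  G (- H) E) => [|u|u|u];
  rewrite ?opp_lfunE //.
by rewrite homN (tripleHE triple) opprD subrK.
Qed.

Let expE_H v : exp_nilpotent E (H v) = H (exp_nilpotent E v)
  - 2 *: E (exp_nilpotent E v).
Proof.
rewrite (@exp_nilpotent_conj _ charK0 _ _ raising_nilpotent
  H (- 2 *: E) 0) => [|u|u|u];
  rewrite ?scale_lfunE ?zero_lfunE ?scaler0 ?addr0 //.
- by rewrite scaleNr.
- by rewrite (tripleHE triple) scaleNr addrK.
- by rewrite homZ.
- by rewrite hom0.
Qed.

(** Passing the three factors, [E] becomes [E + H + G], then [E + (H - 2 E) + (G - H + E) = G], then
    [G]. The next two computations run likewise. *)
Lemma weyl_raising v : h (E v) = G (h v).
Proof.
rewrite !weylE expG_E !homD expE_E expE_G expE_H !homE !expG_E !expG_H !expG_G.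
module_ring.
Qed.

Lemma weyl_lowering v : h (G v) = E (h v).
Proof.
by rewrite !weylE expG_G expE_G !homE !expG_E !expG_H !expG_G; module_ring.
Qed.

Lemma weyl_weight v : h (H v) = - H (h v).
Proof.
rewrite !weylE expG_H !homE expE_G expE_H !homE !expG_E !expG_H !expG_G.
module_ring.
Qed.

(** In characteristic zero [d - 2 i] differs from [d] for [i > 0], so comparing coefficients in
    [H u = d u] leaves only that of [w 0]. *)
Lemma highest_weight_line u : H u = d%:R *: u -> exists b, u = b *: w 0%N.
Proof.
move=> Hu; pose X := in_tuple (mkseq w d.+1).
have nz2 : 2 != 0 :> K by rewrite natr_eq0_pchar0.
have X_free : free X := basis_free (weight_span wb).
have XE (i : 'I_(size (mkseq w d.+1))) : X`_i = w i.
  by rewrite nth_mkseq // (leq_trans (ltn_ord i)) ?size_mkseq.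
have Du : u = \sum_i coord X i u *: X`_i.
  by apply: coord_span; rewrite (span_basis (weight_span wb)) memvf.
have c0 (i : 'I_(size (mkseq w d.+1))) : (0 < i)%N -> coord X i u = 0.
  move=> i_gt0; apply/eqP.
  have/eqP : coord X i u * (- 2 * i%:R) = 0.
    apply: (freeP X_free (fun i => coord X i u * (- 2 * i%:R))).
    rewrite -[RHS](subrr (H u)) {2}Hu {2 3}Du hom_sum scaler_sumr -sumrB.
    apply: eq_bigr => j _; rewrite homZ XE (weightH wb) !scalerA -scalerBl.
    by congr (_ *: _); ring.
  rewrite !mulf_eq0 oppr_eq0 (negPf nz2) natr_eq0_pchar0 //.
  rewrite [(i : nat) == _]eqn0Ngt.
  by rewrite i_gt0 orbF.
have lt_0 : (0 < size (mkseq w d.+1))%N by rewrite size_mkseq.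
exists (coord X (Ordinal lt_0) u); rewrite {1}Du (bigD1 (Ordinal lt_0)) //=.
rewrite big1 ?addr0 // => i i_neq0; rewrite c0 ?scale0r // lt0n.
by apply: contraNneq i_neq0 => i0; apply/eqP/val_inj.
Qed.

(** As [h] reverses weights, [h (w d) = b w 0] for some [b]. Applying [G^d], which kills every [w i]
    with [i > 0], gives [b = 1]. *)
Lemma weyl_lowest : h (w d) = w 0%N.
Proof.
have [b hwd] : exists b, h (w d) = b *: w 0%N.
  apply: highest_weight_line; apply: oppr_inj; rewrite -weyl_weight.
  by rewrite (weightH wb) homZ -scaleNr; congr (_ *: _); ring.
have Gd0 v : iter d.+1 G v = 0 by rewrite -dimV lowering_nilpotent.
have iterG : iter d G (w 0%N) != 0.
  rewrite lowering_iter add0n scaler_eq0 negb_or; apply/andP; split.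
    apply/prodf_neq0 => i _; rewrite oppr_eq0 natr_eq0_pchar0 //.
  have /free_not0 := basis_free (weight_span wb).
  by apply; apply/map_f; rewrite mem_iota ltnSn.
suff : iter d G (h (w d)) = iter d G (w 0%N).
  rewrite hwd -!lfun_iterE homZ lfun_iterE => /eqP.
  rewrite -subr_eq0 -[X in _ - X]scale1r -scalerBl scaler_eq0 (negPf iterG).
  by rewrite orbF subr_eq0 => /eqP ->; rewrite scale1r.
(* Only the constant term of the exponential survives, because [G^(d+1) = 0]. *)
have expG_fixed v : iter d G (exp_nilpotent G v) = iter d G v.
  rewrite (exp_nilpotent_sum lowering_nilpotent _ (leqnn _)) dimV big_ord_recl.
  rewrite -!lfun_iterE homD hom_sum divpow0 big1 ?addr0 // => i _.
  rewrite divpowE homZ lfun_iterE -iterD /= addnS -addSn addnC iterD Gd0.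
  by rewrite iter_hom0 scaler0.
rewrite weylE expG_fixed (exp_nilpotent_fixed lowering_nilpotent (v := w d)).
  (* [exp_nilpotent E (w d)] is the sum of the [w (d - n)], of which [G^d] keeps only the last,
     [w 0]. *)
  rewrite (exp_nilpotent_sum raising_nilpotent _ (leqnn _)) dimV big_ord_recr /=.
  rewrite -!lfun_iterE homD hom_sum big1 ?add0r ?divpow_raising ?subnn // => i _.
  rewrite divpow_raising ?(ltnW (ltn_ord i)) // lfun_iterE lowering_iter.
  rewrite (weight_gt wb) ?scaler0 // -[X in (X < _)%N]add0n ltn_add2r.
  by rewrite subn_gt0.
by rewrite lowering_weight (weight_gt wb) ?scaler0.
Qed.

(** [h] takes the n-th divided power of [E] at [w d] to that of [G] at [w 0], so [w (d - n)] goes to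
    [(-1)^n w n]. Two applications to [w i] give the sign [(-1)^(d-i) (-1)^i]. *)
Lemma weyl_sqr : (h \o h)%VF = (-1) ^+ d *: \1%VF.
Proof.
have hw n : (n <= d)%N -> h (w (d - n)%N) = (-1) ^+ n *: w n.
  move=> le_nd; rewrite -divpow_raising // (divpow_comm _ _ weyl_raising).
  by rewrite weyl_lowest divpow_lowering.
apply: (weight_basis_ext wb) => i le_id.
rewrite comp_lfunE scale_lfunE id_lfunE -{1}(subKn le_id) hw ?leq_subr //.
by rewrite homZ hw // scalerA -exprD subnK.
Qed.

End WeylElement.

(** * Maps out of the model space [K^(d+1)] *)

Section RowSpace.
Variables (K : fieldType) (V : vectType K) (d : nat).

Lemma row_hom_exists (v : nat -> V) : exists g : 'Hom('rV[K]_d.+1, V),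
  forall r, g r = \sum_(i < d.+1) r 0 i *: v i.
Proof.
pose phi (r : 'rV[K]_d.+1) := \sum_(i < d.+1) r 0 i *: v i.
have phi_lin : linear phi.
  move=> a r t; rewrite /phi scaler_sumr -big_split; apply: eq_bigr => i _.
  by rewrite !mxE scalerDl scalerA.
pose phiM := GRing.isLinear.Build _ _ _ _ phi phi_lin.
pose phiL : {linear 'rV[K]_d.+1 -> V} := HB.pack phi phiM.
by exists (linfun phiL) => r; rewrite lfunE.
Qed.

Lemma Bvec_delta (i : 'I_d.+1) : Bvec K d i%:Z = 'e_i.
Proof. by apply/rowP => k; rewrite !mxE eqz_nat eq_sym. Qed.

Lemma Bvec_eq0 (j : int) : (forall k : 'I_d.+1, j != k%:Z) -> Bvec K d j = 0.
Proof. by move=> jP; apply/rowP => k; rewrite !mxE (negPf (jP k)). Qed.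

Lemma Bvec_ext (f g : 'Hom('rV[K]_d.+1, V)) :
  (forall i, (i <= d)%N -> f (Bvec K d i%:Z) = g (Bvec K d i%:Z)) -> f = g.
Proof.
move=> fg; apply/lfunP => r; rewrite (row_sum_delta r) !hom_sum.
by apply: eq_bigr => i _; rewrite !homZ -Bvec_delta fg // -ltnS.
Qed.

End RowSpace.

(** * The bracket relations and the triples they contain *)

Section CyclicRelations.
Variables (K : fieldType) (ii : K) (ii_sqr : ii ^+ 2 = -1).
Variables (charK0 : [pchar K] =i pred0) (V : vectType K).

Record cyclic_relations (X Y Z : 'End(V)) : Prop := CyclicRelations {
  cyclicXY : forall v, X (Y v) = Y (X v) + (2 * ii) *: Z v;
  cyclicYZ : forall v, Y (Z v) = Z (Y v) + (2 * ii) *: X v;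
  cyclicZX : forall v, Z (X v) = X (Z v) + (2 * ii) *: Y v
}.

(** The symmetry permits a choice of the semisimple element: [Z] for the study of [h], [X] for the
    basis of type B. *)
Lemma cyclic_relations_rot X Y Z :
  cyclic_relations X Y Z -> cyclic_relations Z X Y.
Proof. by case. Qed.

(** Under the cyclic relations, this and [lowering] are eigenvectors of [ad X] for 2 and -2. *)
Definition raising (Y Z : 'End(V)) := 2^-1 *: (Y + ii *: Z).
Definition lowering (Y Z : 'End(V)) := 2^-1 *: (Y - ii *: Z).

Lemma raisingE Y Z v : raising Y Z v = 2^-1 *: (Y v + ii *: Z v).
Proof. by rewrite /raising scale_lfunE add_lfunE scale_lfunE. Qed.

Lemma loweringE Y Z v : lowering Y Z v = 2^-1 *: (Y v - ii *: Z v).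
Proof. by rewrite /lowering scale_lfunE add_lfunE opp_lfunE scale_lfunE. Qed.

Let nz2 : 2 != 0 :> K.
Proof. by rewrite natr_eq0_pchar0. Qed.

Lemma raising_lowering_sum (Y Z : 'End(V)) v :
  Y v = raising Y Z v + lowering Y Z v.
Proof.
rewrite raisingE loweringE; apply: eq_scalar => phi; module_expand phi.
by field.
Qed.

Lemma raising_lowering_diff (Y Z : 'End(V)) v :
  ii *: Z v = raising Y Z v - lowering Y Z v.
Proof.
rewrite raisingE loweringE; apply: eq_scalar => phi; module_expand phi.
by field.
Qed.

Lemma cyclic_triple X Y Z : cyclic_relations X Y Z ->
  sl2_triple (raising Y Z) X (lowering Y Z).
Proof.
move=> [XY YZ ZX].
have XZ v : X (Z v) = Z (X v) - (2 * ii) *: Y v by rewrite ZX addrK.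
have ZY v : Z (Y v) = Y (Z v) - (2 * ii) *: X v by rewrite YZ addrK.
split=> v; rewrite !(raisingE, loweringE) !homE ?XY ?XZ ?YZ.
- by apply: eq_scalar => phi; module_expand phi; field: ii_sqr.
- by apply: eq_scalar => phi; module_expand phi; field: ii_sqr.
- by apply: eq_scalar => phi; module_expand phi; field: ii_sqr.
Qed.

End CyclicRelations.

(** * Twisting by an involution *)

Section Twist.
Variables (K : closedFieldType) (ii : K) (ii_sqr : ii ^+ 2 = -1).
Variables (charK0 : [pchar K] =i pred0) (V : vectType K) (d : nat).
Variables (X Y Z s : 'End(V)).
Hypotheses (d_even : ~~ odd d) (dimV : \dim {:V} = d.+1).
Hypothesis XYZ : cyclic_relations ii X Y Z.
Hypothesis irr : forall W : {vspace V},
  (X @: W <= W)%VS -> (Y @: W <= W)%VS -> (Z @: W <= W)%VS ->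
  W = 0%VS \/ W = fullv.
Hypotheses (ssK : forall v, s (s v) = v) (sX : forall v, s (X v) = - X (s v)).
Hypotheses (sY : forall v, s (Y v) = Y (s v)).
Hypothesis sZ : forall v, s (Z v) = - Z (s v).

Let x := X.
Let y := (s \o Y)%VF.
Let z := - ii *: (s \o Z)%VF.

Let yE v : y v = s (Y v). Proof. by rewrite /y comp_lfunE. Qed.
Let zE v : z v = - ii *: s (Z v).
Proof. by rewrite /z scale_lfunE comp_lfunE. Qed.

Let sZE v : s (Z v) = ii *: z v.
Proof. by rewrite zE scalerA mulrN -expr2 ii_sqr opprK scale1r. Qed.

(** Moving [s] past [X] and [Z] changes signs and turns anticommutators into commutators: [x y + y x
    = - s [X, Y]], [y z + z y = - i [Y, Z]], [z x + x z = - i s [Z, X]]. *)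
Lemma twist_A_module : A_module x y z.
Proof.
have [XY YZ ZX] := XYZ.
split; apply/lfunP => v;
  rewrite add_lfunE scale_lfunE !comp_lfunE ?zE ?comp_lfunE /x ?homE;
  rewrite !(sX, sY, sZ, homE) ?ssK ?(XY, YZ, ZX);
  by apply: eq_scalar => phi; module_expand phi; ring: ii_sqr.
Qed.

Lemma twist_A_irreducible : A_irreducible x y z.
Proof.
split=> [|W [/lfun_imgP xW /lfun_imgP yW /lfun_imgP zW]].
  by rewrite -dimv_eq0 dimV.
have ker_s : lker s == 0%VS.
  by apply/lker0P => u v /(congr1 s); rewrite !ssK.
have sK u : u \in W -> s u \in (s @: W)%VS by apply: memv_img.
have YW : (Y @: W <= s @: W)%VS.
  by apply/lfun_imgP => u /yW; rewrite yE => /sK; rewrite ssK.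
have ZW : (Z @: W <= s @: W)%VS.
  by apply/lfun_imgP => u /zW /(memvZ ii); rewrite -sZE => /sK; rewrite ssK.
have XsW : (X @: (s @: W) <= s @: W)%VS.
  apply/lfun_imgP => _ /memv_imgP[u uW ->].
  by rewrite -[X _]opprK -sX memvN sK // xW.
have YsW : (Y @: (s @: W) <= W)%VS.
  by apply/lfun_imgP => _ /memv_imgP[u /yW uW ->]; rewrite -sY -yE.
have ZsW : (Z @: (s @: W) <= W)%VS.
  apply/lfun_imgP => _ /memv_imgP[u /zW uW ->].
  by rewrite -[Z _]opprK -sZ memvN sZE memvZ.
have XW : (X @: W <= W)%VS by apply/lfun_imgP.
(* [Y] and [Z] exchange [W] and [s W], hence preserve their intersection and sum; [X] preserves each
   of the two and is treated apart. *)
have stable (f : 'End(V)) : (f @: (s @: W) <= W)%VS -> (f @: W <= s @: W)%VS ->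
    (f @: (W :&: s @: W) <= W :&: s @: W)%VS /\
    (f @: (W + s @: W) <= W + s @: W)%VS.
  move=> fsW fW; split.
    rewrite subv_cap (subv_trans _ fsW) ?(subv_trans _ fW) ?limgS //.
      exact: capvSl.
    exact: capvSr.
  by rewrite limgD addvC; apply: addvS.
have stableX : (X @: (W :&: s @: W) <= W :&: s @: W)%VS /\
    (X @: (W + s @: W) <= W + s @: W)%VS.
  split; last by rewrite limgD; apply: addvS.
  rewrite subv_cap (subv_trans _ XW) ?(subv_trans _ XsW) ?limgS //.
    exact: capvSr.
  exact: capvSl.
have [capY addY] := stable Y YsW YW; have [capZ addZ] := stable Z ZsW ZW.
have [cap0|capV] := irr stableX.1 capY capZ; last first.
  by right; apply/eqP; rewrite eqEsubv subvf -capV capvSl.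
have [add0|addV] := irr stableX.2 addY addZ.
  by left; apply/eqP; rewrite -subv0 -add0 addvSl.
have dim_sW : \dim (s @: W) = \dim W.
  by apply: limg_dim_eq; rewrite (eqP ker_s) capv0.
have := dimv_disjoint_sum cap0; rewrite addV dimV dim_sW addnn.
by move/(congr1 odd); rewrite odd_double /= d_even.
Qed.

Let E := raising ii Y Z.
Let F := lowering ii Y Z.

Let sE v : s (E v) = F (s v).
Proof. by rewrite /E /F raisingE loweringE !homE sY sZ scalerN. Qed.

Let sF v : s (F v) = E (s v).
Proof. by rewrite /E /F raisingE loweringE !homE sY sZ scalerN opprK. Qed.

(** The map [g] goes from the model to [V]. Once it intertwines the actions, its image is a nonzero
    submodule, so irreducibility makes it onto and equality of dimensions makes it bijective. *)
Lemma twist_A_type_B : A_type_B d x y z.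
Proof.
have triple : sl2_triple E X F by apply: cyclic_triple.
have YEF v : Y v = E v + F v by apply: raising_lowering_sum.
have iiZ v : ii *: Z v = E v - F v by apply: raising_lowering_diff.
have [w wb] : exists w, weight_basis E X F d w.
  apply: weight_basis_exists => // W /lfun_imgP EW XW /lfun_imgP FW.
  apply: irr => //; apply/lfun_imgP => v vW; first by rewrite YEF memvD ?EW ?FW.
  rewrite -[Z v]scale1r -[1]opprK -ii_sqr -mulrN mulrC -scalerA iiZ.
  by rewrite memvZ ?memvB ?EW ?FW.
(* This is [s^i (w i)], as [s] is an involution. *)
pose v i := if odd i then s (w i) else w i.
have v_gt i : (d < i)%N -> v i = 0.
  by move=> lt_di; rewrite /v (weight_gt wb) // hom0 if_same.
have [g gE] := row_hom_exists d v.
have gB (i : nat) : g (Bvec K d i%:Z) = v i.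
  have [le_id|lt_di] := leqP i d; last first.
    rewrite v_gt // Bvec_eq0 ?hom0 // => k.
    by rewrite eqz_nat gtn_eqF // (leq_trans _ lt_di).
  have lt_id : (i < d.+1)%N by [].
  rewrite (Bvec_delta K (Ordinal lt_id)) gE (bigD1 (Ordinal lt_id)) //=.
  rewrite mxE !eqxx scale1r big1 ?addr0 // => j /negPf jP.
  by rewrite mxE jP andbF scale0r.
have gB_pred (i : nat) : g (Bvec K d (i%:Z - 1)) = if i is j.+1 then v j else 0.
  case: i => [|i]; first by rewrite Bvec_eq0 ?hom0.
  by have -> : i.+1%:Z - 1 = i%:Z by rewrite intS addrC addKr.
have gB_succ (i : nat) : g (Bvec K d (i%:Z + 1)) = v i.+1.
  by have -> : i%:Z + 1 = i.+1%:Z by rewrite intS addrC.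
(* [wp i] stands for [w (i - 1)], with value 0 at [i = 0], where the coefficient [d - i + 1] does
   not vanish. *)
pose wp i := if i is j.+1 then w j else 0.
have Ew i : E (w i) = (d%:R - i%:R + 1) *: wp i.
  case: i => [|i]; first by rewrite (weightE0 wb) scaler0.
  by rewrite (weightE wb) -natr1; congr (_ *: _); ring.
have Fw i : F (w i) = (i%:R + 1) *: w i.+1 by rewrite (weightF wb) natr1.
have gx : (g \o Bx K d)%VF = (x \o g)%VF.
  apply: Bvec_ext => i le_id; rewrite !comp_lfunE BendE // homZ gB /x /v.
  rewrite -signr_odd; case: odd; rewrite ?mul1r ?(weightH wb) //.
  by rewrite -[X _]opprK -sX (weightH wb) homZ mulN1r scaleNr.
have v_pred (i : nat) :
    (if i is j.+1 then v j else 0) = if odd i then wp i else s (wp i).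
  by case: i => [|i] /=; rewrite ?hom0 // /v; case: odd.
have v_succ i : v i.+1 = if odd i then w i.+1 else s (w i.+1).
  by rewrite /v /=; case: odd.
(* For odd [i] the [s] in [y] cancels the one in [v i] and exchanges [E] and [F], which leaves
   [Y = E + F] unchanged. *)
have gy : (g \o By K d)%VF = (y \o g)%VF.
  apply: Bvec_ext => i le_id.
  rewrite !comp_lfunE BendE // homD !homZ gB_pred gB_succ gB v_pred v_succ /v.
  case: odd; rewrite YEF homD; last by rewrite Ew Fw !homZ.
  by rewrite sE sF ssK Ew Fw addrC.
(* Here [z] acts as [s (F - E)], so the same exchange produces the sign [(-1)^i]. *)
have gz : (g \o Bz K d)%VF = (z \o g)%VF.
  apply: Bvec_ext => i le_id; rewrite !comp_lfunE BendE // zE -homZ scaleNr iiZ.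
  rewrite homD !homZ gB_pred gB_succ gB v_pred v_succ /v exprS -signr_odd.
  case: odd; rewrite /= ?expr0 ?expr1 homN homB.
    by rewrite sE sF ssK Ew Fw; module_ring.
  by rewrite Ew Fw !homZ; module_ring.
have nzw0 : w 0%N != 0.
  have /free_not0 := basis_free (weight_span wb).
  by apply; apply/map_f; rewrite mem_iota.
have limg_g : limg g = fullv.
  have [_ irrA] := twist_A_irreducible.
  have stable (f : 'End(V)) b : (g \o b)%VF = (f \o g)%VF ->
      (f @: limg g <= limg g)%VS.
    by move=> gb; rewrite -limg_comp -gb limg_comp limgS ?subvf.
  have [||//] := irrA (limg g).
    by split; [apply: stable gx | apply: stable gy | apply: stable gz].
  move=> g0; have := memv_img g (memvf (Bvec K d 0)).
  by rewrite g0 memv0 gB (negPf nzw0).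
have ker_g : lker g == 0%VS.
  have := limg_ker_dim g fullv; rewrite limg_g dimV capfv dimvf /dim /= mul1n.
  by move/(canRL (addnK _)); rewrite subnn => /eqP; rewrite dimv_eq0.
have g_sur u : exists r, u = g r.
  by have /memv_imgP[r _ ->] : u \in limg g; [rewrite limg_g memvf | exists r].
have gK := lker0_lfunK ker_g.
have gV u : g (g^-1%VF u) = u by have [r ->] := g_sur u; rewrite gK.
have interV (f : 'End(V)) b : (g \o b)%VF = (f \o g)%VF ->
    forall u, g^-1%VF (f u) = b (g^-1%VF u).
  move=> gb u; have [r ->] := g_sur u; rewrite gK.
  by rewrite -[f (g r)]comp_lfunE -gb comp_lfunE gK.
exists g^-1%VF; split; [by exists g | exact: interV..].
Qed.

End Twist.

(** * Representations in terms of the basis of the Lie algebra *)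

Section Representation.
Variables (K : fieldType) (ii : K) (V : vectType K).
Variable rho : {linear sl2 K -> 'End(V)}.
Let X := rho (sl2X K).
Let Y := rho (sl2Y K).
Let Z := rho (sl2Z K).

Lemma sl2_module_cyclic : sl2_module ii rho -> cyclic_relations ii X Y Z.
Proof.
move=> rhoP.
have rhoE u v a t : sl2_bracket ii u v = a *: t ->
    forall x, rho u (rho v x) = rho v (rho u x) + a *: rho t x.
  move=> uv x; have /lfunP/(_ x) := rhoP u v.
  rewrite uv linearZ /= scale_lfunE add_lfunE opp_lfunE !comp_lfunE => ->.
  by rewrite addrC subrK.
split; apply: rhoE; [exact: sl2_bracketXY | exact: sl2_bracketYZ |].
exact: sl2_bracketZX.
Qed.

Lemma sl2_submodule_basis (W : {vspace V}) :
  (X @: W <= W)%VS -> (Y @: W <= W)%VS -> (Z @: W <= W)%VS ->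
  sl2_submodule rho W.
Proof.
move=> /lfun_imgP XW /lfun_imgP YW /lfun_imgP ZW u; apply/lfun_imgP => v vW.
rewrite [u]row_sum_delta 2!big_ord_recl big_ord1 !linearD !linearZ /=.
have -> : lift ord0 ord0 = 1 :> 'I_3 by apply/val_inj.
have -> : lift ord0 (lift ord0 ord0) = 2 :> 'I_3 by apply/val_inj.
by rewrite !add_lfunE !scale_lfunE !memvD ?memvZ ?XW ?YW ?ZW.
Qed.

End Representation.

(** * The operator [h] and the two structures *)

(** Since [X = N+ - N-] and [Y = - i (N+ + N-)], the exchange of [N+] and [N-] by [h] yields the
    signs for [X] and [Y]. *)
Lemma h_op_twist (K : closedFieldType) (charK0 : [pchar K] =i pred0)
  (ii : K) (ii_sqr : ii ^+ 2 = -1) (d : nat)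
  (V : vectType K) (rho : {linear sl2 K -> 'End(V)})
  (V_module : sl2_module ii rho) (V_irr : sl2_irreducible rho fullv)
  (V_dim : \dim {:V} = d.+1) (h := h_op ii rho) :
  [/\ forall v, h (h v) = (-1) ^+ d *: v,
      forall v, h (rho (sl2X K) v) = - rho (sl2X K) (h v),
      forall v, h (rho (sl2Y K) v) = rho (sl2Y K) (h v)
    & forall v, h (rho (sl2Z K) v) = - rho (sl2Z K) (h v)].
Proof.
set X := rho (sl2X K); set Y := rho (sl2Y K); set Z := rho (sl2Z K).
have ZXY := cyclic_relations_rot (sl2_module_cyclic V_module).
rewrite -/X -/Y -/Z in ZXY.
have triple := cyclic_triple ii_sqr charK0 ZXY.
have NpE : Nplus ii rho = raising ii X Y.
  by rewrite /Nplus /raising addrC.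
have NmE : lowering ii X Y = - Nminus ii rho.
  by rewrite /Nminus /lowering -[RHS]scalerN opprB.
rewrite -NpE NmE in triple.
have XE v : X v = Nplus ii rho v - Nminus ii rho v.
  by rewrite (raising_lowering_sum ii charK0 X Y) -NpE NmE opp_lfunE.
have YE v : Y v = - ii *: (Nplus ii rho v + Nminus ii rho v).
  rewrite -[Nminus _ _]opprK opp_lfunE -NmE NpE -raising_lowering_diff //.
  by rewrite scalerA mulNr -expr2 ii_sqr opprK scale1r.
have [_ _ irr] := V_irr.
have [w wb] : exists w, weight_basis (Nplus ii rho) Z (- Nminus ii rho) d w.
  apply: weight_basis_exists => // W /lfun_imgP PW ZW.
  move=> /lfun_imgP MW; apply: irr; last exact: subvf.
  have MW' v : v \in W -> Nminus ii rho v \in W.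
    by move/MW; rewrite opp_lfunE memvN.
  apply: sl2_submodule_basis => //; apply/lfun_imgP => v vW.
    by rewrite XE memvB ?PW ?MW'.
  by rewrite YE memvZ ?memvD ?PW ?MW'.
have hP := weyl_raising charK0 V_dim triple wb.
have hM := weyl_lowering charK0 V_dim triple wb.
have hZ := weyl_weight charK0 V_dim triple wb.
have := weyl_sqr charK0 V_dim triple wb.
rewrite -/(h_op ii rho) -/h in hP hM hZ * => hh.
split=> // v.
- by rewrite -comp_lfunE hh scale_lfunE id_lfunE.
- by rewrite !XE homB hP hM opprB.
- by rewrite !YE homZ homD hP hM addrC.
Qed.

Theorem theorem5p16 (K : closedFieldType) (charK0 : [pchar K] =i pred0)
  (ii : K) (ii_sqr : ii ^+ 2 = -1)
  (d : nat) (d_even : ~~ odd d)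
  (V : vectType K) (rho : {linear sl2 K -> 'End(V)})
  (V_module : sl2_module ii rho)
  (V_irr : sl2_irreducible rho fullv)
  (V_dim : \dim {:V} = d.+1)
  (k : 'End(V)) (k_op : is_k_op ii rho k) :
  let s := s_op ii rho k in
  let X := rho (sl2X K) in
  let Y := rho (sl2Y K) in
  let Z := rho (sl2Z K) in
  (let x := X in
   let y := (s \o Y)%VF in
   let z := - ii *: (s \o Z)%VF in
   [/\ A_module x y z, A_irreducible x y z & A_type_B d x y z]) /\
  (let x := X in
   let y := - (s \o Y)%VF in
   let z := ii *: (s \o Z)%VF in
   [/\ A_module x y z, A_irreducible x y z & A_type_B d x y z]).
Proof.
have [hh hX hY hZ] := h_op_twist charK0 ii_sqr V_module V_irr V_dim.
have k1 : k = \1%VF.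
  by rewrite (iffLR (is_k_op_irreducible ii k V_irr) k_op) V_dim /= d_even.
have sh : s_op ii rho k = h_op ii rho by rewrite /s_op k1 comp_lfun1r.
move=> s X Y Z; rewrite -{}sh -/s -/X -/Y -/Z in hh hX hY hZ.
have irr (W : {vspace V}) : (X @: W <= W)%VS -> (Y @: W <= W)%VS ->
    (Z @: W <= W)%VS -> W = 0%VS \/ W = fullv.
  move=> XW YW ZW; have [_ _ irrV] := V_irr.
  by apply: irrV (subvf W); apply: sl2_submodule_basis.
have XYZ := sl2_module_cyclic V_module.
have twist (t : 'End(V)) : (forall v, t (t v) = v) ->
    (forall v, t (X v) = - X (t v)) -> (forall v, t (Y v) = Y (t v)) ->
    (forall v, t (Z v) = - Z (t v)) ->
    let y := (t \o Y)%VF in let z := - ii *: (t \o Z)%VF in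
    [/\ A_module X y z, A_irreducible X y z & A_type_B d X y z].
  move=> tt tX tY tZ; split.
  - exact: twist_A_module.
  - exact: (twist_A_irreducible ii_sqr d_even V_dim).
  - exact: twist_A_type_B.
have ss v : s (s v) = v by rewrite hh -signr_odd (negPf d_even) scale1r.
split; first exact: twist.
(* The second structure is the first with [- s] in place of [s], and [- s] satisfies the same
   relations. *)
have -> : ii *: (s \o Z)%VF = - ii *: ((- s) \o Z)%VF.
  by rewrite comp_lfunNl scalerN scaleNr opprK.
move=> x y z; rewrite /y -comp_lfunNl; apply: twist => v;
  by rewrite !opp_lfunE ?homN ?ss ?hX ?hY ?hZ ?opprK.
Qed.
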